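(* Let $(X,\mathbb{R})$ be a topological flow with the small flow boundary property (SFBP), let $w,w'\in X$ be distinct points, and let $\epsilon$ be as in the construction described in the context. Then the continuous function $\Theta_\epsilon:X\to[0,1]$ constructed there, given by $\Theta_\epsilon(tx)=\min\{f_\epsilon(x),g_\epsilon(t)\}$ for $(t,x)\in[-\eta,\eta]\times S$ and $\Theta_\epsilon=0$ outside $[-\eta,\eta]S$, has the following properties: (1) $\Theta_\epsilon(w)\neq\Theta_\epsilon(w')$; (2) for every $\mathbb{R}$-invariant Borel probability measure $\mu$ on $X$, $\mu(\widetilde A)=0$, where $$\widetilde A:=\Bigl\{z\in X:\ \Theta_\epsilon(z)\neq\frac{k}{2^n}\ \text{for all integers }k,n\ge0\Bigr\}.$$
   Context: **Flows and SFBP.** A topological flow $(X,\mathbb{R})$ is a compact metrizable space $X$ with a continuous action $(t,x)\mapsto tx$ of $\mathbb{R}$. It is fixed-point free if no $x\in X$ satisfies $tx=x$ for all $t$. For $A\subset X$ and $s<s'$ write $[s,s']A=\{ta:t\in[s,s'],a\in A\}$. A cross-section with injectivity time $\eta>0$ is a set $S\subset X$ such that $[-\eta,\eta]\times S\to X$, $(t,x)\mapsto tx$, is injective; it is global if $[-\xi,\xi]S=X$ for some $\xi>0$. For a subset $U$ of a closed cross-section with injectivity time $\eta$, the flow interior is $\mathrm{Int}^{\mathbb{R}}U:=\mathrm{Int}([-\eta,\eta]U)\cap U$ (interior in $X$) and the flow boundary is $\partial^{\mathbb{R}}U:=\overline U\setminus\mathrm{Int}^{\mathbb{R}}U$. A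 set is null if it has measure zero for every $\mathbb{R}$-invariant Borel probability measure on $X$. A closed cross-section $S$ with injectivity time $\eta$ has a small flow boundary if $[-\eta,\eta](\partial^{\mathbb{R}}S)$ is null. The flow has SFBP if it is fixed-point free and for each $x\in X$ and each closed cross-section $S'$ with $x\in\mathrm{Int}^{\mathbb{R}}(S')$ there is a closed subset $S\subset S'$ with $x\in\mathrm{Int}^{\mathbb{R}}(S)$ and with small flow boundary. For a subset $A$ of a cross-section, the counting orbit capacity is $$\mathrm{ocap}_\#(A):=\lim_{T\to\infty}\frac1T\max_{x\in X}|\{0\le t\le T:tx\in A\}|.$$ **Construction of $\Theta_\epsilon$.** Fix distinct $w,w'\in X$ and a global closed cross-section $S$ with injectivity time $\eta>0$ and $w,w'\in S$. Put $a:=2\,\mathrm{ocap}_\#(\{w\})$. Fix $\epsilon\in(0,\eta)$, with moreover $\epsilon<a$ if $a>0$. Write $\partial_S$ for the boundary in the subspace topology of $S$. *Step 1 (clean seamless family).* Using SFBP, one chooses a family $\mathcal U=\{U_n\}_{n\ge0}$ of relatively open subsets of $S$, with $U_0=\mathrm{Int}^{\mathbb{R}}U_0$ and $\overline{U_n}\cap\partial^{\mathbb{R}}S=\emptyset$ for all $n$, such that: $w\in U_0\setminus\bigcup_{n\ge1}U_n$; $w'\notin\overline{U_0}$ and $w'\notin\bigcup_{n\ge0}U_n$; for all $n\ge0$, $\partial_SU_n\subset U_{n+1}$; for all $n\ge 0$ and $m\ge n+2$, $\partial_SU_n\cap\overline{U_m}=\emptyset$; $\mathrm{ocap}_\#(\partial_SU_n)=0$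 for all $n\ge0$; $\mathrm{ocap}_\#(U_0)<\frac a2+\frac\epsilon4$; and $\mathrm{ocap}_\#(U_n)<\epsilon/2^{2n+2}$ for all $n\ge1$. For $n\ge0$ let $\mathcal P_n$ be the finite partition of $S$ generated by $U_0,\dots,U_n$ (its atoms are the nonempty sets $\bigcap_{j=0}^nA_j$ with $A_j\in\{U_j,U_j^c\}$, complements in $S$), and let $\mathcal P_{-1}=\{S\}$. An atom $P$ of $\mathcal P_{n-1}$ is essential if $P\cap\partial_SU_n\ne\emptyset$ and inessential otherwise. The family is also taken to be clean: for each $n\ge1$, every inessential atom $P$ of $\mathcal P_{n-1}$ satisfies $P\cap U_{n+1}=\emptyset$. *Step 2 (the function $f_\epsilon:S\to[0,1]$).* If $\partial_SU_n\neq\emptyset$ for all $n\ge0$, put $f_0=1_{U_0}$ and inductively, for $n\ge0$, let $f_{n+1}=f_n$ on $S\setminus U_{n+1}$, and on $P\cap U_{n+1}$, for each essential atom $P$ of $\mathcal P_{n-1}$, let $f_{n+1}$ be the constant equal to the average of the constant values of $f_n$ on $P\cap U_n\cap U_{n+1}$ and on $P\cap U_n^c\cap U_{n+1}$. Then $f_n$ converges uniformly and $f_\epsilon:=\lim_nf_n$. If $\partial_SU_n=\emptyset$ for some $n$, take the least such $n$ and put $f_\epsilon:=1_{U_0\setminus\bigcup_{m=1}^nU_m}$. The function $f_\epsilon$ is continuous, $f_\epsilon(w)=1$, $f_\epsilon(w')=0$, and $f_\epsilon=0$ on $\partial^{\mathbb{R}}S$. *Step 3 (the function $g_\epsilon$).*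 Let $D:[0,1]\to[0,1]$ be the standard Cantor staircase function ($D(0)=0$, $D(1)=1$). Define $g_\epsilon:[-\eta,\eta]\to[0,1]$ by $g_\epsilon(t)=1-D(|t|/\epsilon)$ for $|t|\le\epsilon$ and $g_\epsilon(t)=0$ otherwise. *Step 4.* Every $z\in[-\eta,\eta]S$ is uniquely $z=t_zx_z$ with $(t_z,x_z)\in[-\eta,\eta]\times S$. Define $\Theta_\epsilon(z)=\min\{f_\epsilon(x_z),g_\epsilon(t_z)\}$ for such $z$, and $\Theta_\epsilon(z)=0$ for $z\notin[-\eta,\eta]S$. The function $\Theta_\epsilon:X\to[0,1]$ is continuous. Here $\mu(\widetilde A)$ is understood with respect to the $\mu$-completion of the Borel $\sigma$-algebra. *)

(* Defs.v *)
From HB Require Import structures.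
From mathcomp Require Import all_boot all_order all_algebra.
From mathcomp Require Import all_classical all_reals all_analysis.

Set Implicit Arguments.
Unset Strict Implicit.
Unset Printing Implicit Defensive.

Import Order.TTheory GRing.Theory Num.Theory.
Import numFieldNormedType.Exports.

Local Open Scope classical_set_scope.
Local Open Scope ring_scope.

(* Pointed metric spaces: the library's measurable types must be pointed. *)
#[short(type="pmetricType")]
HB.structure Definition PointedMetric (R : numDomainType) :=
  { T of Pointed T & Metric R T }.

Notation borelType X := (g_sigma_algebraType (@open X)).

Section Flow.
Context {R : realType} {X : pmetricType R} (phi : R -> X -> X).

Record topological_flow : Prop := TopologicalFlow {
  flow_compact : compact [set: X] ;
  flow_continuous : continuous (fun p : R * X => phi p.1 p.2) ;
  flow0 : forall x, phi 0 x = x ;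
  flowD : forall s t x, phi (s + t) x = phi s (phi t x) }.

Definition fixed_point_free := ~ exists x, forall t, phi t x = x.

Definition flow_box (s s' : R) (A : set X) : set X :=
  [set phi t a | t in `[s, s']%classic & a in A].

Definition cross_section (eta : R) (S : set X) :=
  0 < eta /\
  {in `[- eta, eta]%classic `*` S &, injective (fun p : R * X => phi p.1 p.2)}.

Definition closed_cross_section (eta : R) (S : set X) :=
  closed S /\ cross_section eta S.

Definition global_section (S : set X) :=
  exists2 xi : R, 0 < xi & flow_box (- xi) xi S = [set: X].

(* For U contained in a closed cross-section with injectivity time eta, the
   next two sets do not depend on the choice of the injectivity time eta. *)
Definition flow_interior (eta : R) (U : set X) : set X :=
  interior (flow_box (- eta) eta U) `&` U.

Definition flow_boundary (eta : R) (U : set X) : set X :=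
  closure U `\` flow_interior eta U.

Definition flow_invariant (mu : probability (borelType X) R) :=
  forall t (A : set (borelType X)),
    measurable A -> mu (phi t @^-1` A) = mu A.

(* mu.-negligible A says that A has measure zero for the completion of mu. *)
Definition flow_null (A : set X) :=
  forall mu : probability (borelType X) R, flow_invariant mu -> mu.-negligible A.

Definition small_flow_boundary (eta : R) (S : set X) :=
  flow_null (flow_box (- eta) eta (flow_boundary eta S)).

Definition SFBP :=
  fixed_point_free /\
  forall (x : X) (eta : R) (S' : set X),
    closed_cross_section eta S' -> flow_interior eta S' x ->
    exists S : set X, [/\ closed S, S `<=` S', flow_interior eta S x
                        & small_flow_boundary eta S].

Definition visits (A : set X) (x : X) (T : R) : set R :=
  [set t | 0 <= t <= T /\ A (phi t x)].

(* Counting orbit capacity.  For A in a cross-section the numbers of visits up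
   to time T are finite and bounded in x, so the supremum is a maximum. *)
Definition ocap (A : set X) : \bar R :=
  lim ((T^-1)%:E * ereal_sup [set counting (visits A x T) | x in [set: X]]
       @[T --> +oo%R])%E.

(* Boundary of U in the subspace topology of S; points outside S are isolated
   in subspace S, so this is the intended set for U `<=` S. *)
Definition rel_boundary (S U : set X) : set X :=
  @closure (subspace S) U `\` @interior (subspace S) U.

Section Family.
Variables (S : set X) (U : nat -> set X).

Local Notation bd n := (rel_boundary S (U n)).

(* atoms n is the partition of S generated by U 0, ..., U n.-1, with the shift
   atoms n = P_(n-1); in particular atoms 0 = P_(-1) = {S}. *)
Definition atoms (n : nat) : set (set X) :=
  [set P | P !=set0 /\ exists A : nat -> set X,
     (forall j, (j < n)%N -> A j = U j \/ A j = S `\` U j) /\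
     P = S `&` \bigcap_(j in `I_n) A j].

Definition essential (n : nat) (P : set X) :=
  atoms n P /\ P `&` bd n !=set0.

Definition inessential (n : nat) (P : set X) :=
  atoms n P /\ P `&` bd n = set0.

Record clean_seamless_family (eta eps : R) (w w' : X) : Prop :=
  CleanSeamlessFamily {
  csf_sub : forall n, U n `<=` S ;
  csf_open : forall n, open (U n : set (subspace S)) ;
  csf_int0 : U 0%N = flow_interior eta (U 0%N) ;
  csf_flow_boundary : forall n, closure (U n) `&` flow_boundary eta S = set0 ;
  csf_w : (U 0%N `\` \bigcup_(n in [set n | (1 <= n)%N]) U n) w ;
  csf_w'_closure : ~ closure (U 0%N) w' ;
  csf_w' : ~ (\bigcup_n U n) w' ;
  csf_next : forall n, bd n `<=` U n.+1 ;
  csf_far : forall n m, (n.+2 <= m)%N -> bd n `&` closure (U m) = set0 ;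
  csf_ocap_bd : forall n, ocap (bd n) = 0%E ;
  csf_ocap0 :
    (ocap (U 0%N) < (2%:E * ocap [set w]) * (2^-1)%:E + (eps / 4)%:E)%E ;
  csf_ocap : forall n, (1 <= n)%N ->
    (ocap (U n) < (eps / 2 ^+ (2 * n + 2))%:E)%E ;
  csf_clean : forall n P, (1 <= n)%N -> inessential n P ->
    P `&` U n.+1 = set0 }.

(* The constant value of f on B, when B is nonempty and f is constant on B. *)
Definition const_value (f : X -> R) (B : set X) : R :=
  xget 0 [set v | f @` B = [set v]].

Definition f_step (n : nat) (f : X -> R) (x : X) : R :=
  xget (f x) [set v | exists P : set X,
    [/\ essential n P, (P `&` U n.+1) x &
        v = (const_value f (P `&` U n `&` U n.+1) +
             const_value f (P `&` (S `\` U n) `&` U n.+1)) / 2]].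

Fixpoint f_seq (n : nat) : X -> R :=
  if n is m.+1 then f_step m (f_seq m) else \1_(U 0%N).

Definition first_empty_boundary : nat :=
  xget 0%N [set n | bd n = set0 /\ forall m, (m < n)%N -> bd m !=set0].

(* Only the values on S are meaningful. *)
Definition f_eps (x : X) : R :=
  if `[< forall n, bd n !=set0 >] then lim (f_seq n x @[n --> \oo])
  else \1_(U 0%N `\`
           \bigcup_(m in [set m | (1 <= m <= first_empty_boundary)%N]) U m) x.

End Family.
End Flow.

(* On [0, 1], these converge uniformly to the Cantor staircase function. *)
Fixpoint cantor_approx {R : realType} (n : nat) (x : R) : R :=
  if n is m.+1 then
    if x <= 1 / 3 then cantor_approx m (3 * x) / 2
    else if x < 2 / 3 then 1 / 2
    else 1 / 2 + cantor_approx m (3 * x - 2) / 2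
  else x.

Definition cantor_staircase {R : realType} (x : R) : R :=
  lim (cantor_approx n x @[n --> \oo]).

Definition g_eps {R : realType} (eps t : R) : R :=
  if `|t| <= eps then 1 - cantor_staircase (`|t| / eps) else 0.

Definition Theta {R : realType} {X : pmetricType R} (phi : R -> X -> X)
    (S : set X) (eta : R) (U : nat -> set X) (eps : R) (z : X) : R :=
  xget 0 [set r | exists (t : R) (x : X), [/\ t \in `[- eta, eta], S x,
                    phi t x = z & r = Num.min (f_eps S U x) (g_eps eps t)]].

(* Main.v *)
(** The averages [f_n] take dyadic values only, and a point [x] of [S] lying in
    finitely many [U_n] has [f_n x] eventually constant; hence [f_eps x] can fail
    to be dyadic only on [limsup U_n].  Likewise [g_eps t] is dyadic unless
    [|t| / eps] is in the Cantor set.  Both exceptional sets sweep out null sets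
    under the flow, by one and the same estimate: an invariant measure of a flow
    box [[s, s + d]A] is at most (1/N) times the maximal number of visits to [A]
    during a time [2 N d].  With the bound on [ocap (U_n)] this gives a summable
    sequence of measures and Borel-Cantelli applies; with the trivial bound on
    visits to [S] it shows that a box of length [d] has measure O(d), so that the
    [2^n] intervals of length [3^-n] covering the Cantor set contribute at most
    O((2/3)^n). *)

Require Import Defs.
From mathcomp Require Import all_boot all_order all_algebra.
From mathcomp Require Import all_classical all_reals all_analysis.
From mathcomp Require Import measurable_realfun zify ring lra.

Import Order.TTheory GRing.Theory Num.Theory.
Import numFieldNormedType.Exports.

Local Open Scope classical_set_scope.
Local Open Scope ring_scope.

Set Implicit Arguments.
Unset Strict Implicit.
Unset Printing Implicit Defensive.

(** * Dyadic values *)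

Definition dyadic {R : realType} (r : R) := exists k n : nat, r = k%:R / 2 ^+ n.

Lemma dyadic0 (R : realType) : dyadic (0 : R).
Proof. by exists 0%N, 0%N; rewrite mul0r. Qed.

Lemma dyadic1 (R : realType) : dyadic (1 : R).
Proof. by exists 1%N, 0%N; rewrite expr0 divr1. Qed.

Lemma dyadic_half (R : realType) (a : R) : dyadic a -> dyadic (a / 2).
Proof. by move=> [k [n ->]]; exists k, n.+1; rewrite exprSr invfM mulrA. Qed.

Lemma dyadicD (R : realType) (a b : R) : dyadic a -> dyadic b -> dyadic (a + b).
Proof.
move=> [k [n ->]] [l [m ->]]; exists (k * 2 ^ m + l * 2 ^ n)%N, (n + m)%N.
have n0 : 2 ^+ n != 0 :> R by rewrite expf_neq0.
have m0 : 2 ^+ m != 0 :> R by rewrite expf_neq0.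
rewrite natrD !natrM !natrX exprD; field.
by rewrite n0 m0.
Qed.

Lemma dyadic_sub1 (R : realType) (a : R) : a <= 1 -> dyadic a -> dyadic (1 - a).
Proof.
move=> + [k [n E]]; subst a.
have n0 : 0 < 2 ^+ n :> R by rewrite exprn_gt0.
rewrite ler_pdivrMr// mul1r -natrX ler_nat => kn.
exists (2 ^ n - k)%N, n; rewrite natrB// natrX mulrBl divff ?gt_eqF//.
Qed.

(** * The Cantor staircase and the non-dyadic values of [g_eps] *)

Section Staircase.
Context {R : realType}.
Implicit Types (x : R) (n : nat).

Lemma cantor_approx_bound n x : 0 <= x <= 1 -> 0 <= cantor_approx n x <= 1.
Proof.
elim: n x => [//|n IH] x x01 /=.
case: ifPn => [x3|]; first by have := IH (3 * x); lra.
rewrite -ltNge => x3; case: ifPn => [|]; first by lra.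
rewrite -leNgt => x23.
by have := IH (3 * x - 2); lra.
Qed.

Lemma cantor_approx0 n : cantor_approx n (0 : R) = 0.
Proof. by elim: n => [//|n IH] /=; rewrite mulr0 IH ifT ?mul0r//; lra. Qed.

Lemma cantor_staircase0 : cantor_staircase (0 : R) = 0.
Proof.
rewrite /cantor_staircase (_ : (fun n => _) = fun=> 0); first exact: lim_cst.
by apply/funext => n; rewrite cantor_approx0.
Qed.

(* Left endpoints of the [2 ^ n] intervals of length [3 ^- n] that remain after
   [n] steps of the construction of the Cantor set. *)
Fixpoint cantor_left n : seq R :=
  if n is m.+1 then
    [seq c / 3 | c <- cantor_left m] ++ [seq (2 + c) / 3 | c <- cantor_left m]
  else [:: 0].

Lemma size_cantor_left n : size (cantor_left n) = (2 ^ n)%N.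
Proof.
by elim: n => // n IH; rewrite /= size_cat !size_map IH addnn -mul2n expnS.
Qed.

(** By self-similarity: on either outer third an approximant is a rescaled copy of the preceding
    one, and on the open middle third all approximants of index at least 1 equal 1/2. *)
Lemma cantor_approx_gap n x : 0 <= x <= 1 ->
  (exists2 c, c \in cantor_left n & c <= x <= c + 3^-1 ^+ n) \/
  exists2 d, dyadic d & forall m, (n <= m)%N -> cantor_approx m x = d.
Proof.
elim: n x => [|n IH] x x01.
  by left; exists 0; rewrite ?inE// expr0 add0r.
have [x3|x3] := leP x (1 / 3).
  have /IH[[c cn cx]|[d dd dE]] : 0 <= 3 * x <= 1 by lra.
    left; exists (c / 3).
      by rewrite /= mem_cat; apply/orP; left; apply/mapP; exists c.
    by rewrite exprS; move: cx; set u := _ ^+ n; lra.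
  right; exists (d / 2); first exact: dyadic_half.
  by case=> // m nm /=; rewrite x3 dE.
have [x23|x23] := ltP x (2 / 3).
  right; exists (1 / 2); first exact: dyadic_half (dyadic1 R).
  by case=> // m nm /=; rewrite x23 leNgt x3.
have /IH[[c cn cx]|[d dd dE]] : 0 <= 3 * x - 2 <= 1 by lra.
  left; exists ((2 + c) / 3).
    by rewrite /= mem_cat; apply/orP; right; apply/mapP; exists c.
  by rewrite exprS; move: cx; set u := _ ^+ n; lra.
right; exists (1 / 2 + d / 2).
  by apply: dyadicD; apply: dyadic_half => //; exact: dyadic1.
by case=> // m nm /=; rewrite leNgt x3/= ltNge x23/= dE.
Qed.

Lemma g_eps_gap n (eps t : R) : 0 < eps ->
  (exists2 c, c \in cantor_left n & c <= `|t| / eps <= c + 3^-1 ^+ n) \/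
  dyadic (g_eps eps t).
Proof.
move=> e0; rewrite /g_eps; case: ifPn => [te|_]; last by right; exact: dyadic0.
have t01 : 0 <= `|t| / eps <= 1.
  by rewrite divr_ge0 ?(ltW e0)//= ler_pdivrMr// mul1r.
have [|[d dd dE]] := cantor_approx_gap n t01; [by left|right].
(* The approximants at this point are eventually equal to [d], hence so is their limit. *)
suff -> : cantor_staircase (`|t| / eps) = d.
  apply: dyadic_sub1 => //; rewrite -(dE n)//.
  by have /andP[] := cantor_approx_bound n t01.
apply: lim_near_cst => //; near=> m; apply: dE; near: m; exact: nbhs_infty_ge.
Unshelve. all: by end_near. Qed.

Lemma g_eps0 (eps : R) : 0 <= eps -> g_eps eps 0 = 1.
Proof. by rewrite /g_eps normr0 mul0r cantor_staircase0 subr0 => ->. Qed.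

End Staircase.

(** * Dyadic values of [f_seq] and [f_eps] *)

Section Functions.
Context {R : realType} {X : pmetricType R}.
Variables (S : set X) (U : nat -> set X).

Lemma dyadic_indic (A : set X) x : dyadic (\1_A x : R).
Proof.
by rewrite indicE; case: (_ \in _); [exact: dyadic1|exact: dyadic0].
Qed.

(** Either the constant value is attained by [f] at a point of [B], or [xget] returns its default 0;
    both are dyadic. *)
Lemma dyadic_const_value (f : X -> R) (B : set X) :
  (forall x, dyadic (f x)) -> dyadic (const_value f B).
Proof.
move=> fd; rewrite /const_value; case: xgetP => [v _ fB|_]; last exact: dyadic0.
have [x _ <-] : (f @` B) v by rewrite fB.
exact: fd.
Qed.

Lemma dyadic_f_seq n x : dyadic (f_seq S U n x : R).
Proof.
elim: n x => [|n IH] x; first exact: dyadic_indic.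
rewrite /= /f_step; case: xgetP => // v _ [P [_ _ ->]].
by apply: dyadic_half; apply: dyadicD; exact: dyadic_const_value.
Qed.

Lemma f_seq_notin n x : ~ U n.+1 x -> f_seq S U n.+1 x = f_seq S U n x.
Proof.
by move=> Ux; rewrite /= /f_step; case: xgetP => // v _ [P [_ [_ /Ux]]].
Qed.


Lemma f_seq_stable n m x : (forall m, (n < m)%N -> ~ U m x) -> (n <= m)%N ->
  f_seq S U m x = f_seq S U n x.
Proof.
move=> Ux; elim: m => [|m IH]; first by rewrite leqn0 => /eqP ->.
rewrite leq_eqVlt => /predU1P[->//|nm].
by rewrite f_seq_notin ?IH//; exact: Ux.
Qed.

Lemma f_eps_stable n x : (forall m, (n < m)%N -> ~ U m x) ->
  (forall k, rel_boundary S (U k) !=set0) -> f_eps S U x = f_seq S U n x.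
Proof.
move=> Ux bd0; rewrite /f_eps asboolT//; apply: lim_near_cst => //.
by near=> m; apply: f_seq_stable => //; near: m; exact: nbhs_infty_ge.
Unshelve. all: by end_near. Qed.

(** Serves to evaluate [f_eps] at [w] and [w'], which lie in no [U m] with [m > 0]; both branches of
    the definition then reduce to the indicator of [U 0]. *)
Lemma f_eps_notin x : (forall m, (0 < m)%N -> ~ U m x) ->
  f_eps S U x = \1_(U 0%N) x.
Proof.
move=> Ux.
have [bd0|] := pselect (forall k, rel_boundary S (U k) !=set0).
  by rewrite (f_eps_stable Ux).
move=> bdN; rewrite /f_eps asboolF// !indicE; congr (nat_of_bool _)%:R.
apply/idP/idP; rewrite !inE; first by case.
by move=> U0; split=> // -[m /andP[/Ux]].
Qed.

(** The shift drops [U 0], whose orbit capacity need not be small; membership in a lim sup does not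
    depend on it. *)
Lemma f_eps_dyadic x : ~ lim_sup_set (fun n => U n.+1) x ->
  dyadic (f_eps S U x : R).
Proof.
move=> /existsNP[n Un].
have [bd0|bdN] := pselect (forall k, rel_boundary S (U k) !=set0).
  rewrite (@f_eps_stable n)//; first exact: dyadic_f_seq.
  by case=> // m nm Ux; apply: Un; exists m.
by rewrite /f_eps asboolF//; exact: dyadic_indic.
Qed.

End Functions.

(** * Visits to a cross-section *)

Section Counting.
Context {R : realType} {T : choiceType}.
Implicit Types A B : set T.
Local Open Scope ereal_scope.

Lemma counting_le A m : (A #<= `I_m)%card -> @counting T R A <= m%:R%:E.
Proof.
move=> Am; have fA : finite_set A by apply/finite_set_leP; exists m.
by rewrite /counting asboolT// lee_fin ler_nat geq_card_fset_set.
Qed.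

Lemma counting_ge A m : (`I_m #<= A)%card -> m%:R%:E <= @counting T R A.
Proof.
move=> Am; rewrite /counting; case: asboolP => fA; last by rewrite leey.
by rewrite lee_fin ler_nat leq_card_fset_set.
Qed.

Lemma counting_ge0 A : 0 <= @counting T R A.
Proof. by rewrite /counting; case: asboolP => // _; rewrite lee_fin. Qed.

Lemma le_counting A B : A `<=` B -> @counting T R A <= counting B.
Proof.
move=> AB; rewrite /counting; case: asboolP => fA; case: asboolP => fB //.
- by rewrite lee_fin ler_nat finmap.fsubset_leq_card// -fset_set_sub.
- by rewrite leey.
- by case: fA; exact: sub_finite_set fB.
Qed.

Lemma counting_setU A B : @counting T R (A `|` B) <= counting A + counting B.
Proof.
rewrite {2 3}/counting; case: asboolP => fA; case: asboolP => fB;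
  rewrite ?addye ?addey ?leey//.
rewrite /counting asboolT ?finite_setU// fset_setU//.
by rewrite -EFinD -natrD lee_fin ler_nat finmap.cardfsU leq_subr.
Qed.

End Counting.

Lemma counting_image {R : realType} {T T' : choiceType} (f : T -> T')
    (A : set T) :
  (@counting T' R (f @` A) <= counting A)%E.
Proof.
rewrite {2}/counting; case: asboolP => fA; last by rewrite leey.
apply: counting_le; apply: card_le_trans (card_image_le _ _) _.
have [n An] := fA.
by rewrite (card_le_eql An) card_le_II (card_fset_set An).
Qed.

(** Fekete's lemma in continuous time, the limit being the infimum [L]. Monotonicity allows [T] to
    be rounded up to a multiple of a nearly optimal [t]. *)
Lemma fekete_cvg {R : realType} (b : R -> R) :
  (forall T, 0 <= b T) -> {homo b : s t / s <= t} ->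
  (forall s t, 0 <= s -> 0 <= t -> b (s + t) <= b s + b t) ->
  cvg (T^-1 * b T @[T --> +oo]).
Proof.
move=> b0 bm bD.
pose L := inf [set T^-1 * b T | T in `]0, +oo[%classic].
have LB : has_inf [set T^-1 * b T | T in `]0, +oo[%classic].
  split; first by exists (1^-1 * b 1); exists 1 => //=; rewrite in_itv/= ltr01.
  exists 0 => _ [T /= + <-]; rewrite in_itv/= andbT => T0.
  by rewrite mulr_ge0 ?invr_ge0 ?(ltW T0).
have bn n (t : R) : 0 <= t -> b (n.+1%:R * t) <= n.+1%:R * b t.
  move=> t0; elim: n => [|n IH]; first by rewrite !mul1r.
  rewrite -[n.+2%:R]natr1 !mulrDl !mul1r (le_trans (bD _ _ _ _))//.
    by rewrite mulr_ge0.
  by rewrite lerD2r.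
apply/cvg_ex; exists L; apply/cvgrPdist_le => e e0.
have [_ [t /= + <-] tL] := inf_adherent (divr_gt0 e0 (ltr0n _ 2)) LB.
rewrite in_itv/= andbT => t0.
near=> T.
have T0 : 0 < T by near: T; apply: nbhs_pinfty_gt; rewrite num_real.
rewrite distrC ger0_norm; last first.
  rewrite subr_ge0; apply: ge_inf; first by case: LB.
  by exists T => //=; rewrite in_itv/= T0.
rewrite lerBlDl.
(* [T] lies below [n.+1] periods [t], and the incomplete period costs at most one extra [b t]. *)
set n := Num.truncn (T / t).
have /truncn_itv/andP[nT Tn] : 0 <= T / t by rewrite divr_ge0 ?ltW.
have bT : b T <= (T / t + 1) * b t.
  apply: le_trans (_ : n.+1%:R * b t <= _).
    apply: le_trans (bn n _ (ltW t0)).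
    by apply: bm; rewrite -ler_pdivrMr// ltW.
  by rewrite ler_wpM2r// -natr1 lerD2r.
(* This makes the rounding error [T^-1 * b t] at most [e / 2]. *)
have bTe : b t * (2 / e) <= T.
  by near: T; apply: nbhs_pinfty_ge; rewrite num_real.
rewrite -/L in tL.
have -> : L + e = (L + e / 2) + e / 2 by field.
apply: le_trans (_ : t^-1 * b t + T^-1 * b t <= _).
  rewrite -mulrDl mulrC ler_pdivrMr// (le_trans bT)// mulrAC ler_wpM2r//.
  by rewrite mulrDl mulVf ?gt_eqF// (mulrC T).
apply: lerD; first exact: ltW.
by rewrite mulrC ler_pdivrMr// mulrC -ler_pdivrMr ?divr_gt0// invf_div.
Unshelve. all: by end_near. Qed.

(** * Flow boxes, visit counts and existence of the orbit capacity *)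

Section FlowTheory.
Context {R : realType} {X : pmetricType R} (phi : R -> X -> X).
Hypothesis hflow : topological_flow phi.
Implicit Types (A S : set X) (x z : X).

Lemma flowN t x : phi (- t) (phi t x) = x.
Proof. by rewrite -(flowD hflow) addNr (flow0 hflow). Qed.

Lemma flow_time_continuous t : continuous (phi t).
Proof.
move=> x; apply: (@cvg_comp _ _ _ (fun y => (t, y)) (fun p => phi p.1 p.2) _
  (nbhs (t, x)));
  last by have := flow_continuous hflow (x := (t, x)); exact.
by apply: (@cvg_pair _ _ _ (nbhs x) (nbhs t) (nbhs x) _ _ _ (fun=> t) id);
  [exact: cvg_cst|exact: cvg_id].
Qed.

Lemma borel_open (A : set (borelType X)) : open (A : set X) -> measurable A.
Proof. exact: sub_sigma_algebra. Qed.

Lemma borel_closed (A : set (borelType X)) :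
  closed (A : set X) -> measurable A.
Proof.
move=> cA; rewrite -(setCK A); apply: measurableC; apply: borel_open.
exact: closed_openC.
Qed.

Lemma measurable_flow t :
  measurable_fun [set: borelType X] (phi t : borelType X -> borelType X).
Proof.
apply: (@measurability _ _ (borelType X) (borelType X) setT (phi t) (@open X))
  => // _ [B oB <-]; rewrite setTI.
apply: borel_open; apply: open_comp => // x _; exact: flow_time_continuous.
Qed.

Lemma measurable_flow_preimage t (A : set (borelType X)) :
  measurable A -> measurable (phi t @^-1` A : set (borelType X)).
Proof. by move=> mA; rewrite -[_ @^-1` _]setTI; exact: measurable_flow. Qed.

Lemma closed_flow_box s s' A : closed A -> closed (flow_box phi s s' A).
Proof.
move=> cA; apply: compact_closed; first exact: metric_hausdorff.
have -> : flow_box phi s s' A =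
    (fun p : R * X => phi p.1 p.2) @` (`[s, s'] `*` A).
  apply/seteqP; split=> [_ [t ts [a aA <-]]|_ [[t a] [/= ts aA] <-]].
    by exists (t, a).
  by exists t => //; exists a.
apply: continuous_compact.
  by apply: continuous_subspaceT; exact: (flow_continuous hflow).
apply: compact_setX; first exact: segment_compact.
exact: (subclosed_compact cA (flow_compact hflow)).
Qed.

Definition max_visits A (T : R) : \bar R :=
  ereal_sup [set counting (visits phi A x T) | x in [set: X]].

Lemma max_visits_ub A x T : (counting (visits phi A x T) <= max_visits A T)%E.
Proof. by apply: ereal_sup_ubound; exists x. Qed.

Lemma max_visits_ge0 A T : (0 <= max_visits A T)%E.
Proof. exact: le_trans (counting_ge0 _) (max_visits_ub A point T). Qed.

Lemma le_max_visits A : {homo max_visits A : s t / s <= t >-> (s <= t)%E}.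
Proof.
move=> s t st; apply: ge_ereal_sup => _ [x _ <-].
apply: le_trans (max_visits_ub A x t).
apply: le_counting => r [/andP[r0 rs] Ar].
by split=> //; rewrite r0 (le_trans rs).
Qed.

(** Visits after time [s] are visits of the orbit of [phi s x], translated by [s]. *)
Lemma max_visitsD A s t : 0 <= s -> 0 <= t ->
  (max_visits A (s + t) <= max_visits A s + max_visits A t)%E.
Proof.
move=> s0 t0; apply: ge_ereal_sup => _ [x _ <-].
apply: le_trans (leeD (max_visits_ub A x s) (max_visits_ub A (phi s x) t)).
apply: le_trans (leeD2l _ (@counting_image _ _ _ (fun r => s + r) _)).
apply: le_trans (counting_setU _ _); apply: le_counting => r [/andP[r0 rst] Ar].
have [rs|/ltW sr] := leP r s; first by left; rewrite /visits/= r0 rs.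
right; exists (r - s); last by rewrite addrC subrK.
by split; [rewrite subr_ge0 sr/= lerBlDl|rewrite -(flowD hflow) subrK].
Qed.

Section CrossSection.
Variables (eta : R) (S : set X).
Hypothesis hS : closed_cross_section phi eta S.

Let eta_gt0 : 0 < eta. Proof. by case: hS => _ []. Qed.

Lemma section_inj t t' x x' : `|t| <= eta -> `|t'| <= eta -> S x -> S x' ->
  phi t x = phi t' x' -> (t, x) = (t', x').
Proof.
move=> te te' Sx Sx' txx; case: hS => _ [_ inj].
by apply: inj; rewrite // inE; split => //=; rewrite in_itv/= -ler_norml.
Qed.

(* By injectivity, [s,s']A is the compact set [s,s']S minus the compact set
   [s,s'](S \ A). *)
Lemma measurable_flow_box A : A `<=` S -> open (A : set (subspace S)) ->
  measurable (flow_box phi (- eta) eta A : set (borelType X)).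
Proof.
move=> AS oA.
have -> : flow_box phi (- eta) eta A =
    flow_box phi (- eta) eta S `\` flow_box phi (- eta) eta (S `\` A).
  apply/seteqP; split=> [_ [t ts [a aA <-]]|_ [[t ts [a aS <-]]] ntA].
    split; first by exists t => //; exists a => //; exact: AS.
    case=> t' ts' [a' [Sa' nAa'] E].
    have [_ aE] : (t', a') = (t, a).
      apply: section_inj E => //; try exact: AS.
        by move: ts'; rewrite /= in_itv/= -ler_norml.
      by move: ts; rewrite /= in_itv/= -ler_norml.
    by apply: nAa'; rewrite aE.
  exists t => //; exists a => //; apply: contrapT => nA; apply: ntA.
  by exists t => //; exists a.
apply: measurableD; apply: borel_closed; apply: closed_flow_box.
  by case: hS.
have [V oV VS] := (open_subspaceP _ _).1 oA.
have -> : S `\` A = S `&` ~` V.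
  apply/seteqP; split=> x [Sx nA]; split=> //.
    by move=> Vx; apply: nA; have [] : (A `&` S) x by rewrite -VS.
  by move=> Ax; apply: nA; have [] : (V `&` S) x by rewrite VS.
apply: closedI; first by case: hS.
exact: open_closedC.
Qed.

(** Each half-open time window of length [2 * eta] contains at most one visit, so the index of the
    window is an injective function of the visit time. *)
Lemma visits_bound A x T : A `<=` S ->
  (counting (visits phi A x T) <=
    (Num.truncn (T / (2 * eta))).+1%:R%:E :> \bar R)%E.
Proof.
move=> AS; apply: counting_le.
apply: (@card_le_trans _ _ _
  ((fun t => Num.truncn (t / (2 * eta))) @` visits phi A x T)); last first.
  apply: subset_card_le => _ [t [/andP[t0 tT] _] <-] /=.
  rewrite ltnS; apply: le_truncn; rewrite ler_wpM2r// invr_ge0.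
  by rewrite mulr_ge0// ltW.
set g := (fun _ => _).
have ginj : {in visits phi A x T &, injective g}.
  wlog : / forall t t', visits phi A x T t -> visits phi A x T t' ->
      g t = g t' -> t <= t' -> t = t'.
    apply => t t' [/andP[t0 tT] Ax] [/andP[t0' tT'] Ax'] gE tt'.
    have e2 : 0 < 2 * eta by rewrite mulr_gt0.
    have /truncn_itv/andP[_ b1] : 0 <= t' / (2 * eta) by rewrite divr_ge0// ltW.
    have /truncn_itv/andP[a1 _] : 0 <= t / (2 * eta) by rewrite divr_ge0// ltW.
    have d : t' - t < 2 * eta.
      move: a1 b1; rewrite -/(g t) -/(g t') gE => a1 b1.
      have : t' / (2 * eta) - t / (2 * eta) < 1.
        move: a1 b1; rewrite -[(g t').+1%:R]natr1.
        by move: (t / _) (t' / _) (g t')%:R => u v k; lra.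
      by rewrite -mulrBl ltr_pdivrMr// mul1r.
    (* Both visits flow to the midpoint of the orbit segment between them in time less than [eta],
       against injectivity unless [t = t']. *)
    have : (- ((t' - t) / 2), phi t' x) = ((t' - t) / 2, phi t x).
      apply: section_inj; [| |exact: AS|exact: AS|].
      - by rewrite normrN ger0_norm; lra.
      - by rewrite ger0_norm; lra.
      - by rewrite -!(flowD hflow); congr (phi _ x); field.
    by move=> [+ _]; lra.
  move=> H t t'; rewrite !inE => vt vt' gE.
  by have [tt'|/ltW tt'] := leP t t'; [exact: H|apply/esym; exact: H].
by rewrite -(card_le_eql (inj_card_eq ginj)).
Qed.

Lemma max_visits_bound A T : A `<=` S ->
  (max_visits A T <= (Num.truncn (T / (2 * eta))).+1%:R%:E)%E.
Proof.
by move=> AS; apply: ge_ereal_sup => _ [x _ <-]; exact: visits_bound.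
Qed.

Lemma max_visits_fin_num A T : A `<=` S -> max_visits A T \is a fin_num.
Proof.
move=> AS; rewrite ge0_fin_numE ?max_visits_ge0//.
by rewrite (le_lt_trans (max_visits_bound T AS))// ltry.
Qed.

(** Without convergence [lim] would be a default value; this is what turns a bound on [ocap] into a
    bound on visits up to large times. *)
Lemma ocap_cvg A : A `<=` S ->
  cvg ((T^-1)%:E * max_visits A T @[T --> +oo%R])%E.
Proof.
move=> AS; pose b T := fine (max_visits A T).
have bE T : max_visits A T = (b T)%:E by rewrite fineK// max_visits_fin_num.
have /cvg_ex[l bl] : cvg (T^-1 * b T @[T --> +oo]).
  apply: fekete_cvg => [T|s t st|s t s0 t0].
  - by rewrite -lee_fin -bE max_visits_ge0.
  - by rewrite -lee_fin -!bE le_max_visits.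
  - by rewrite -lee_fin EFinD -!bE max_visitsD.
apply/cvg_ex; exists l%:E.
under eq_fun do rewrite bE -EFinM.
by apply: cvg_EFin => //; exact: nearW.
Qed.

Lemma ocap_lt A (c : R) : A `<=` S -> (ocap phi A < c%:E)%E ->
  \forall T \near +oo%R, (max_visits A T <= (c * T)%:E)%E.
Proof.
move=> AS cA.
have nc : nbhs (ocap phi A) [set y | (y < c%:E)%E].
  by apply: open_nbhs_nbhs; split=> //; exact: open_ereal_lt_ereal.
have H := ocap_cvg AS nc.
near=> T.
have T0 : 0 < T by near: T; apply: nbhs_pinfty_gt; rewrite num_real.
have : ((T^-1)%:E * max_visits A T < c%:E)%E by near: T.
by rewrite muleC EFinM lte_pdivrMr// => /ltW.
Unshelve. all: by end_near. Qed.

End CrossSection.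

(** * Invariant measures of flow boxes *)

Section Invariant.
Variable mu : probability (borelType X) R.
Hypothesis muI : flow_invariant phi mu.

(* The [N] preimages of a flow box of length [d] under the times [2kd], k < N,
   force visits to [A] in disjoint windows of time. *)
Lemma measure_flow_box_visits A (s d : R) (N : nat) : 0 < d ->
  measurable (flow_box phi s (s + d) A : set (borelType X)) ->
  (N%:R%:E * mu (flow_box phi s (s + d) A) <= max_visits A (2 * N%:R * d))%E.
Proof.
move=> d0 mB; set B : set (borelType X) := flow_box phi s (s + d) A.
pose C (k : nat) : set (borelType X) := phi (2 * k%:R * d) @^-1` B.
have mC k : measurable (C k) by exact: measurable_flow_preimage.
(* By invariance [N * mu B] is the integral of the number of [k < N] with [x] in [C k]; since [mu]
   is a probability, a pointwise bound of this number by the maximal number of visits suffices. *)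
have -> : (N%:R%:E * mu B = \sum_(k < N) \int[mu]_x (\1_(C k) x)%:E)%E.
  have muC k : (\int[mu]_x (\1_(C k) x)%:E = mu B)%E.
    by rewrite integral_indic// setIT; exact: muI.
  under eq_bigr do rewrite muC.
  by rewrite sumr_const card_ord; exact: mule_natl.
rewrite -ge0_integral_sum//; last first.
  by move=> k; exact/measurable_EFinP/measurable_indic.
set M := max_visits _ _.
have -> : M = (\int[mu]_x cst M x)%E.
  by rewrite integral_cst//= -/mu probability_setT mule1.
apply: ge0_le_integral => //.
- by move=> x _; apply: sume_ge0 => k _; rewrite lee_fin.
- apply: emeasurable_sum => k; exact/measurable_EFinP/measurable_indic.
move=> x _; rewrite sumEFin.
pose K := [set k : 'I_N | x \in C k]%SET.
have -> : \sum_(k < N) \1_(C k) x = #|K|%:R :> R.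
  rewrite -sum1_card natr_sum [RHS]big_mkcond/=; apply: eq_bigr => k _.
  by rewrite indicE finset.inE; case: (_ \in _).
(* If [phi (2kd) x = phi t a] with [t] in [[s, s + d]], then [x] meets [a] at time [2kd - t].
   Starting from [phi (- (s + d)) x] delays this visit by [s + d], which puts it in
   [[2kd, 2kd + d]]. *)
have /choice[tau tauP] : forall k : nat, exists t, C k x ->
    t \in `[2 * k%:R * d, 2 * k%:R * d + d] /\ A (phi (t - (s + d)) x).
  move=> k; have [[t ts [a Aa tx]]|nC] := pselect (C k x); last by exists 0.
  exists (2 * k%:R * d - t + (s + d)) => _.
  move: ts; rewrite /= !in_itv/= => ts; split; first by lra.
  by rewrite addrK addrC (flowD hflow) -tx flowN.
apply: le_trans (max_visits_ub A (phi (- (s + d)) x) _); apply: counting_ge.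
have KC (i : 'I_#|K|) : C (enum_val i) x.
  by have := enum_valP i; rewrite finset.inE inE.
(* The visit times indexed by an initial segment of the naturals, as [counting_ge] requires; the
   value 0 elsewhere is arbitrary. *)
pose f (i : nat) :=
  if insub i is Some j then tau (@enum_val _ (mem K) j) else 0.
have fE (i : 'I_#|K|) : f i = tau (enum_val i) by rewrite /f valK.
have finj : {in `I_#|K| &, injective f}.
  move=> i j; rewrite !inE/= => iK jK.
  rewrite -[i]/(val (Ordinal iK)) -[j]/(val (Ordinal jK)) !fE => E.
  congr val; apply: enum_val_inj; apply: val_inj => /=.
  have [+ _] := tauP _ (KC (Ordinal iK)).
  have [+ _] := tauP _ (KC (Ordinal jK)).
  rewrite -E !in_itv/=; set t := tau _.
  set p := nat_of_ord _; set q := nat_of_ord _ => tp tq.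
  (* The spacing [2d] leaves gaps between the closed windows of length [d], so a common time forces
     equal indices. *)
  have key (u v : nat) : 2 * u%:R * d <= t <= 2 * u%:R * d + d ->
      2 * v%:R * d <= t <= 2 * v%:R * d + d -> (u <= v)%N.
    move=> tu tv; rewrite -ltnS -(ltr_nat R) -(ltr_pM2r d0) -natr1 mulrDl mul1r.
    lra.
  by apply/eqP; rewrite eqn_leq !key.
rewrite -(card_le_eql (inj_card_eq finj)); apply: subset_card_le => _ [i iK <-].
rewrite -[i]/(val (Ordinal iK)) fE.
have [] := tauP _ (KC (Ordinal iK)); rewrite in_itv/=; set t := tau _.
have : ((nat_of_ord (enum_val (Ordinal iK))).+1 <= N)%N by [].
set k := nat_of_ord _; rewrite -(ler_nat R) -(ler_pM2r d0) -natr1 mulrDl mul1r.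
move=> kN /andP[kt tk] At; split.
  by apply/andP; split; [apply: le_trans kt; rewrite !mulr_ge0// ltW|lra].
by rewrite -(flowD hflow).
Qed.

End Invariant.
End FlowTheory.

(** * Null sets *)

(** The intersection of the covers is a measurable null set containing [Z]; [Z] itself may fail to
    be measurable. *)
Lemma negligible_small d (T : measurableType d) (R : realType)
    (mu : {measure set T -> \bar R}) (Z : set T) :
  (forall n : nat, exists B,
     [/\ measurable B, Z `<=` B & (mu B <= n.+1%:R^-1%:E)%E]) ->
  mu.-negligible Z.
Proof.
move=> /choice[B BP]; exists (\bigcap_n B n).
have mB : measurable (\bigcap_n B n).
  by apply: bigcap_measurable => // n _; have [] := BP n.
split=> //; last by move=> z Zz n _; have [_ + _] := BP n; exact.
apply/eqP; rewrite eq_le measure_ge0 andbT; apply/lee_addgt0Pr => e e0.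
rewrite add0e; set n := Num.truncn e^-1.
have [mBn _ Bn] := BP n.
apply: (@le_trans _ _ (mu (B n))).
  by apply: le_measure; rewrite ?inE//; exact: bigcap_inf.
apply: (le_trans Bn).
rewrite lee_fin -[leRHS]invrK lef_pV2 ?posrE ?invr_gt0// ltW//.
by have /truncn_itv/andP[] : 0 <= e^-1 by rewrite invr_ge0 ltW.
Qed.

Lemma measure_bigsetU_le d (T : measurableType d) (R : realType) (I : Type)
    (mu : {measure set T -> \bar R}) (F : I -> set T) (s : seq I) (K : R) :
  (forall i, measurable (F i)) -> (forall i, mu (F i) <= K%:E)%E ->
  (mu (\big[setU/set0]_(i <- s) F i) <= ((size s)%:R * K)%:E)%E.
Proof.
move=> mF FK; elim: s => [|i s IH]; first by rewrite big_nil measure0 mul0r.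
rewrite big_cons /= -natr1 mulrDl mul1r addrC EFinD.
apply: le_trans (leeD (FK i) IH); apply: measureU2 => //.
exact: bigsetU_measurable.
Qed.

Section FlowNull.
Context {R : realType} {X : pmetricType R} (phi : R -> X -> X).
Hypothesis hflow : topological_flow phi.
Variables (eta : R) (S : set X).
Hypothesis hS : closed_cross_section phi eta S.
Variable mu : probability (borelType X) R.
Hypothesis muI : flow_invariant phi mu.

Let eta_gt0 : 0 < eta. Proof. by case: hS => _ []. Qed.

(** The box has length [2 * eta], so [N] times its measure is at most the number of visits during
    time [4 * N * eta], which is at most [4 * N * eta * c] for large [N]. *)
Lemma measure_flow_box_ocap (A : set X) (c : R) : A `<=` S ->
  open (A : set (subspace S)) -> (ocap phi A < c%:E)%E ->
  (mu (flow_box phi (- eta) eta A) <= (4 * eta * c)%:E)%E.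
Proof.
move=> AS oA /(ocap_lt hflow hS AS)[T [_ HT]].
(* The time [4 * N * eta] exceeds the threshold [T], which may be negative. *)
pose N := (Num.truncn (Num.max 0 T / (4 * eta))).+1.
have e4 : 0 < 4 * eta by rewrite mulr_gt0.
have TN : T < 2 * N%:R * (2 * eta).
  have /truncn_itv/andP[_] : 0 <= Num.max 0 T / (4 * eta).
    by rewrite divr_ge0 ?le_max ?lexx// ltW.
  rewrite -/N ltr_pdivrMr// gt_max => /andP[_].
  by move: N%:R => k; congr (_ < _); ring.
have := HT _ TN => {}HT.
have eE : eta = - eta + 2 * eta by ring.
have := @measure_flow_box_visits _ _ _ hflow _ muI A (- eta) (2 * eta) N.
rewrite -eE mulr_gt0// => /(_ erefl (measurable_flow_box hflow hS AS oA)).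
move=> /le_trans/(_ HT).
rewrite muleC -lee_pdivlMr ?ltr0n// => /le_trans; apply.
rewrite -EFinM lee_fin ler_pdivrMr ?ltr0n//.
by rewrite le_eqVlt; apply/orP; left; apply/eqP; ring.
Qed.

Lemma measurable_section_box s s' :
  measurable (flow_box phi s s' S : set (borelType X)).
Proof.
by apply: borel_closed; apply: (closed_flow_box hflow); case: hS.
Qed.

(** During time [2 * N * d] there are at most [N * d / eta + 1] visits to [S]. Dividing by [N]
    leaves [d / eta + 1 / N], and [N] is taken larger than [1 / d]. *)
Lemma measure_section_box s d : 0 < d ->
  (mu (flow_box phi s (s + d) S) <= (d * (eta^-1 + 1))%:E)%E.
Proof.
move=> d0; pose N := (Num.truncn d^-1).+1.
have dN : d^-1 < N%:R.
  by have /truncn_itv/andP[] : 0 <= d^-1 by rewrite invr_ge0 ltW.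
have N0 : 0 < N%:R :> R by rewrite ltr0n.
have := measure_flow_box_visits hflow muI N d0
  (measurable_section_box s (s + d)).
move=> /le_trans/(_ (max_visits_bound hflow hS _ (@subset_refl _ S))).
rewrite muleC -lee_pdivlMr// => /le_trans; apply.
rewrite -EFinM lee_fin ler_pdivrMr// -natr1.
have T0 : 0 <= 2 * N%:R * d / (2 * eta).
  by rewrite divr_ge0 ?mulr_ge0// ltW// mulr_gt0.
have /truncn_itv/andP[+ _] := T0; move=> /(lerD)/(_ (lexx 1))/le_trans; apply.
have -> : d * (eta^-1 + 1) * N%:R = 2 * N%:R * d / (2 * eta) + d * N%:R.
  by field; rewrite gt_eqF.
by rewrite lerD2l -ler_pdivrMl// mulr1 ltW.
Qed.

Lemma negligible_g_eps (eps : R) : 0 < eps ->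
  mu.-negligible [set z : borelType X | exists (t : R) (x : X),
     [/\ S x, phi t x = z & ~ dyadic (g_eps eps t)]].
Proof.
move=> eps0; apply: negligible_small => k.
(* Each of the [2 ^ n] intervals gives two boxes, one for each sign of [t], of length [eps / 3 ^ n];
   by [measure_section_box] their total measure is at most [(2 / 3) ^ n * K]. *)
pose K := 2 * eps * (eta^-1 + 1).
have K0 : 0 < K by rewrite !mulr_gt0// addr_gt0// invr_gt0.
have [n Kn] : exists n, (2 / 3) ^+ n * K <= k.+1%:R^-1.
  have /cvgrPdist_lt/(_ (k.+1%:R^-1 / K)) :
      (2 / 3 : R) ^+ n @[n --> \oo] --> (0 : R).
    by apply: cvg_expr; rewrite ger0_norm//; lra.
  rewrite divr_gt0// => /(_ erefl)[n _ /(_ n (leqnn _))].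
  rewrite sub0r normrN ger0_norm ?exprn_ge0// ltr_pdivlMr// => /ltW.
  by exists n.
pose d := eps * 3^-1 ^+ n.
have d0 : 0 < d by rewrite mulr_gt0// exprn_gt0.
(* The times [t] with [|t| / eps] in [[c, c + 3 ^- n]]; the right end [- (eps * c)] is written with
   [- d + d] to fit [measure_section_box]. *)
pose F c : set (borelType X) := 
  flow_box phi (eps * c) (eps * c + d) S `|`
  flow_box phi (- (eps * c) - d) (- (eps * c) - d + d) S.
have mF c : measurable (F c).
  by apply: measurableU; exact: measurable_section_box.
exists (\big[setU/set0]_(c <- cantor_left n) F c); split.
- exact: bigsetU_measurable.
- move=> _ [t [x [Sx <- gN]]].
  have [|//] := g_eps_gap n t eps0 => -[c cn /andP[ct tc]].
  rewrite -bigcup_seq; exists c => //=.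
  move: ct tc; rewrite ler_pdivlMr// ler_pdivrMr// mulrDl.
  rewrite -(mulrC eps) -(mulrC eps) -/d => ct tc.
  have [t0|t0] := leP 0 t.
    left; exists t; last by exists x.
    by rewrite /= in_itv/=; move: ct tc; rewrite ger0_norm// => -> ->.
  right; exists t; last by exists x.
  rewrite /= in_itv/=; move: ct tc; rewrite ltr0_norm//.
  by move: (eps * c) => u; lra.
apply: le_trans
  (@measure_bigsetU_le _ _ _ _ _ _ _ (2 * (d * (eta^-1 + 1))) mF _) _.
  move=> c; apply: (@le_trans _ _ (mu (flow_box phi (eps * c) (eps * c + d) S) +
      mu (flow_box phi (- (eps * c) - d) (- (eps * c) - d + d) S))%E).
    by apply: measureU2; exact: measurable_section_box.
  rewrite (_ : 2 * _ = d * (eta^-1 + 1) + d * (eta^-1 + 1)); last by ring.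
  by rewrite EFinD; apply: leeD; exact: measure_section_box.
rewrite lee_fin size_cantor_left; apply: le_trans Kn.
rewrite le_eqVlt; apply/orP; left; apply/eqP.
by rewrite natrX /K /d expr_div_n exprVn; move: (_ ^+ n) (_ ^- n) => a b; ring.
Qed.

Lemma negligible_lim_sup_flow_box (U : nat -> set X) (c : R) :
  (forall n, U n `<=` S) -> (forall n, open (U n : set (subspace S))) ->
  (forall n, ocap phi (U n) < (c / (2 ^ n.+1)%:R)%:E)%E ->
  mu.-negligible
    (lim_sup_set (fun n => flow_box phi (- eta) eta (U n) : set (borelType X))).
Proof.
move=> US oU cU.
have mB n := measurable_flow_box hflow hS (US n) (oU n).
apply/negligibleP.
  apply: bigcap_measurable => // n _; apply: bigcup_measurable => k _.
  exact: mB.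
apply: lim_sup_set_cvg0 => //.
(* Borel-Cantelli: the measures are dominated by a geometric series of ratio 1/2. *)
apply: (@le_lt_trans _ _
  (\sum_(0 <= n <oo) ((4 * eta * c) / (2 ^ (n + 1))%:R)%:E)%E); last first.
  have /cvg_lim := @cvg_geometric_eseries_half R (4 * eta * c) 0.
  by move=> -> //; rewrite ltry.
apply: lee_nneseries => // n _.
rewrite -mulrA addn1; exact: measure_flow_box_ocap.
Qed.

End FlowNull.

(** * Separation of the two points and nullity of the non-dyadic set *)

Theorem theorem5p1 (R : realType) (X : pmetricType R) (phi : R -> X -> X)
    (w w' : X) (S : set X) (eta eps : R) (U : nat -> set X)
    (hflow : topological_flow phi) (hSFBP : SFBP phi)
    (hww' : w <> w')
    (hS : closed_cross_section phi eta S) (hglobal : global_section phi S)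
    (hw : S w) (hw' : S w')
    (heps : 0 < eps < eta)
    (hepsa : let a := (2%:E * ocap phi [set w])%E in
             (0 < a)%E -> (eps%:E < a)%E)
    (hU : clean_seamless_family phi S U eta eps w w') :
  Theta phi S eta U eps w <> Theta phi S eta U eps w' /\
  (forall mu : probability (borelType X) R, flow_invariant phi mu ->
     mu.-negligible [set z : X | forall k n : nat,
                       Theta phi S eta U eps z <> k%:R / 2 ^+ n]).
Proof.
have /andP[eps0 _] := heps.
have eta0 : 0 < eta by case: hS => _ [].
split.
  (* A point of [S] has only the representation with time 0, where [g_eps] is 1. *)
  have ThetaS x : S x -> Theta phi S eta U eps x = Num.min (f_eps S U x) 1.
    move=> Sx; rewrite /Theta; case: xgetP => [r _ [t [y [te Sy tyx ->]]]|].
      have [-> ->] : (t, y) = (0, x).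
        apply: (section_inj hS) => //; last by rewrite tyx (flow0 hflow).
          by move: te; rewrite in_itv/= -ler_norml.
        by rewrite normr0 ltW.
      by rewrite g_eps0// ltW.
    move=> /(_ (Num.min (f_eps S U x) 1)) []; exists 0, x.
    rewrite in_itv/= oppr_le0 ltW//= (flow0 hflow) g_eps0 ?ltW//.
  have [U0w Uw] := csf_w hU.
  rewrite !ThetaS// !f_eps_notin; first last.
  - by move=> m m0 Um; apply: Uw; exists m.
  - by move=> m m0 Um; apply: (csf_w' hU); exists m.
  rewrite !indicE mem_set// memNset; last first.
    by move=> U0; apply: (csf_w' hU); exists 0%N.
  by rewrite minxx min_l// => /eqP; rewrite oner_eq0.
move=> mu muI.
(* The bound [eps / 2 ^ (2n + 4)] is weakened to the rate used for Borel-Cantelli. *)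
have Uocap n : (ocap phi (U n.+1) < (eps / (2 ^ n.+1)%:R)%:E)%E.
  apply: lt_le_trans (csf_ocap hU (ltn0Sn n)) _.
  rewrite lee_fin ler_pM2l// natrX lef_pV2 ?posrE ?exprn_gt0//.
  by rewrite ler_weXn2l ?ler1n//; lia.
have N1 := negligible_lim_sup_flow_box hflow hS muI
  (fun n => @csf_sub _ _ _ _ _ _ _ _ _ hU n.+1)
  (fun n => @csf_open _ _ _ _ _ _ _ _ _ hU n.+1) Uocap.
have N2 := negligible_g_eps hflow hS muI eps0.
apply: (@negligibleS _ _ _ mu) (negligibleU N1 N2) => z zN.
have {}zN : ~ dyadic (Theta phi S eta U eps z) by move=> [k [n]]; exact: zN.
move: zN; rewrite /Theta.
(* Outside the box around [S] the default value 0 is dyadic. *)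
case: xgetP => [_ _ [t [x [te Sx <- ->]]] minN|_]; last first.
  by move=> []; exact: dyadic0.
(* The minimum is one of its two arguments, so a non-dyadic minimum with [g_eps] dyadic forces
   [f_eps] to be non-dyadic. *)
have [gd|gN] := pselect (dyadic (g_eps eps t)); last by right; exists t, x.
left=> n _.
have fN : ~ dyadic (f_eps S U x).
  by move=> fd; apply: minN; rewrite /Num.min; case: ifP.
have /(_ n I)[m nm Um] : lim_sup_set (fun n => U n.+1) x.
  by apply: contrapT => /(f_eps_dyadic (R := R)).
by exists m => //; exists t => //; exists x.
Qed.
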